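(* Let $m\ge 2$ and $v=(-\tfrac1m,-\tfrac2m,\ldots,-\tfrac{m-1}{m})\in\mathbb R^{m-1}$. Then the Kunz polyhedron satisfies $P_m=\mathcal C(\mathbb Z_m)+v$, i.e. $P_m$ is a translation of the group cone $\mathcal C(\mathbb Z_m)$. Moreover, if $F$ is a face of $P_m$ and $S$ is a numerical semigroup containing $m$ whose Kunz coordinate vector $\mathrm{KV}_m(S)$ lies in the relative interior of $F$, then the Kunz poset $\mathcal A(S;m)$ of $S$ equals the Kunz poset of the face $F-v$ of $\mathcal C(\mathbb Z_m)$.
   Context: A numerical semigroup is a subset $S\subseteq\mathbb Z_{\ge0}$ closed under addition with finite complement. For $m\in S$, $m\ge1$, the Apéry set is $\mathrm{Ap}(S;m)=\{s\in S: s-m\notin S\}=\{0,a_1,\ldots,a_{m-1}\}$ where $a_i\equiv i\pmod m$ is the least element of $S$ in its residue class; writing $a_i=k_im+i$, the Kunz coordinate vector is $\mathrm{KV}_m(S)=(k_1,\ldots,k_{m-1})$. The Kunz poset $\mathcal A(S;m)$ is the poset on $\mathbb Z_m$ with $i\preceq j$ iff $a_j-a_i\in S$ (with $a_0=0$). The Kunz polyhedron $P_m\subset\mathbb R^{m-1}$ is the set of $z$ with $z_i+z_j\ge z_{i+j}$ for $1\le i\le j\le m-1$, $i+j<m$, and $z_i+z_j+1\ge z_{i+j-m}$ for $1\le i\le j\le m-1$, $i+j>m$. For a finite abelian group $G$, the group cone $\mathcal C(G)\subset\mathbb R^{|G|-1}$ (coordinates indexed by $G\setminus\{0\}$) is the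 set of $x$ with $x_a+x_b\ge x_{a+b}$ for all nonzero $a,b$ with $a+b\ne0$; here $G=\mathbb Z_m$ with coordinates indexed by $1,\ldots,m-1$. For a face $F'$ of $\mathcal C(G)$, its Kunz subgroup is $H=\{0\}\cup\{h\ne0: x_h=0\ \forall x\in F'\}$, and its Kunz poset is the partial order $\preceq$ on $G/H$ (it exists and is Kunz-balanced) such that for all nonzero $a,b$ with $a+b\neq0$: $x_a+x_b=x_{a+b}$ for all $x\in F'$ iff $\bar a\preceq\bar a+\bar b$, where bars denote images in $G/H$. *)

(* Defs.v *)
From HB Require Import structures.
From mathcomp Require Import all_boot all_order all_fingroup all_algebra.
From mathcomp Require Import boolp classical_sets cardinality reals.

Set Implicit Arguments.
Unset Strict Implicit.
Unset Printing Implicit Defensive.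

Import Order.TTheory GRing.Theory Num.Theory.
Local Open Scope classical_set_scope.
Local Open Scope ring_scope.

Section Convexity.
Variables (R : realType) (I : finType).
Implicit Types (P F : set {ffun I -> R}) (x y : {ffun I -> R}).

(* Faces of a polyhedron are cut out by valid inequalities; taking c = 0 shows *)
(* that P itself and the empty set are faces.                                  *)
Definition is_face P F : Prop :=
  exists (c : {ffun I -> R}) (d : R),
    (forall x, P x -> \sum_i c i * x i <= d) /\
    F = [set x : {ffun I -> R} | P x /\ \sum_i c i * x i = d].

Definition affine_hull F : set {ffun I -> R} :=
  [set y : {ffun I -> R} | exists (n : nat) (t : 'I_n -> R) (p : 'I_n -> {ffun I -> R}),
     [/\ forall k, F (p k), \sum_k t k = 1 &
         forall i, y i = \sum_k t k * p k i]].

(* Sup-norm balls generate the usual topology of R^I. *)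
Definition relative_interior F : set {ffun I -> R} :=
  [set x : {ffun I -> R} | F x /\ exists2 e : R, 0 < e &
     forall y, affine_hull F y -> (forall i, `|y i - x i| < e) -> F y].

End Convexity.

Definition nonzero (G : finZmodType) : finType := {g : G | g != 0}.

Section GroupCone.
Variables (R : realType) (G : finZmodType).

Definition group_cone : set {ffun nonzero G -> R} :=
  [set x : {ffun nonzero G -> R} | forall a b c : nonzero G,
     val a + val b = val c -> x c <= x a + x b].

Definition is_kunz_subgroup (F : set {ffun nonzero G -> R}) (H : {group G}) :
    Prop :=
  forall g : G, g \in H <->
    (g = 0 \/ exists2 h : nonzero G, val h = g & forall x, F x -> x h = 0).

(* The quotient G / H carries multiplicative notation, although its law is     *)
(* induced by the addition of G.                                               *)
Definition kunz_balanced (H : {group G}) (le : rel (coset_of H)) : Prop :=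
  (forall u, le 1%g u) /\ (forall u w, le u w -> le (w * u^-1)%g w).

(* The equivalence alone leaves comparisons with 0 open when H is trivial;     *)
(* being Kunz-balanced settles them (see face_kunz_poset_uniq).                *)
Definition is_face_kunz_poset (F : set {ffun nonzero G -> R}) (H : {group G})
    (le : rel (coset_of H)) : Prop :=
  [/\ is_kunz_subgroup F H,
      [/\ reflexive le, antisymmetric le & transitive le],
      kunz_balanced le &
      forall a b c : nonzero G, val a + val b = val c ->
        (forall x, F x -> x a + x b = x c) <->
        le (coset H (val a)) (coset H (val a) * coset H (val b))%g].

Lemma is_kunz_subgroup_uniq (F : set {ffun nonzero G -> R}) (H K : {group G}) :
  is_kunz_subgroup F H -> is_kunz_subgroup F K -> H = K.
Proof.
move=> FH FK; apply/val_inj/setP => g.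
by apply/idP/idP => [/FH/FK|/FK/FH].
Qed.

Lemma face_kunz_poset_uniq (F : set {ffun nonzero G -> R}) (H : {group G})
    (le1 le2 : rel (coset_of H)) :
  is_face_kunz_poset F le1 -> is_face_kunz_poset F le2 -> le1 =2 le2.
Proof.
move=> [_ [r1 a1 _] [m1 _] e1] [_ [r2 a2 _] [m2 _] e2] u w.
have [->|u1] := eqVneq u 1%g; first by rewrite m1 m2.
have [->|uw] := eqVneq u w; first by rewrite r1 r2.
have [w1|w1] := eqVneq w 1%g.
  by apply/idP/idP => h; case/eqP: uw; [apply: a1|apply: a2];
    rewrite h w1 ?m1 ?m2.
have nH (x : G) : x \in 'N(H)%g.
  suff /fintype.subsetP -> : [set: G]%SET \subset 'N(H)%g by [].
  by apply: sub_abelian_norm; [exact: FinRing.zmod_abelian|exact: finset.subsetT].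
move: u1 uw w1; rewrite -(coset_reprK u) -(coset_reprK w).
move: (repr u) (repr w) => {u w} a b u1 uw w1.
have a0 : a != 0 by apply: contraNneq u1 => ->; rewrite -FinRing.zmod1gE morph1.
have b0 : b != 0 by apply: contraNneq w1 => ->; rewrite -FinRing.zmod1gE morph1.
have c0 : b - a != 0 by rewrite subr_eq0; apply: contraNneq uw => ->.
have := e1 (exist _ a a0) (exist _ (b - a) c0) (exist _ b b0) (subrKC _ _).
have := e2 (exist _ a a0) (exist _ (b - a) c0) (exist _ b b0) (subrKC _ _).
rewrite /= -morphM ?nH // FinRing.zmodMgE subrKC.
by move=> h2 h1; apply/idP/idP => [/h1/h2|/h2/h1].
Qed.

End GroupCone.

Section Semigroup.
Variables (S : set nat) (m : nat).

Definition numerical_semigroup : Prop :=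
  [/\ S 0%N, forall s t, S s -> S t -> S (s + t)%N & finite_set (~` S)].

(* The guard m <= s makes the truncated s - m agree with subtraction in Z.     *)
Definition apery_set : set nat :=
  [set s | S s /\ ~ ((m <= s)%N /\ S (s - m)%N)].

(* For m \in S, the unique element of the Apery set congruent to i modulo m.   *)
Definition apery (i : nat) : nat :=
  xget 0%N [set a | apery_set a /\ a = i %[mod m]].

Definition semigroup_kunz_poset : rel 'Z_m :=
  fun i j => `[< (apery i <= apery j)%N /\ S (apery j - apery i)%N >].

(* The quotient is the k_i of apery i = k_i * m + i, as i < m.                 *)
Definition kunz_vector (R : realType) : {ffun nonzero 'Z_m -> R} :=
  [ffun i : nonzero 'Z_m => (apery (val i) %/ m)%N%:R].

End Semigroup.

(* For 1 < m, the nonzero elements of 'Z_m are the indices 1, ..., m - 1.      *)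
Section Polyhedron.
Variables (R : realType) (m : nat).

Definition kunz_polyhedron : set {ffun nonzero 'Z_m -> R} :=
  [set z : {ffun nonzero 'Z_m -> R} |
    (forall i j k : nonzero 'Z_m, (val i <= val j)%N ->
       (val i + val j < m)%N -> (val k = val i + val j :> nat)%N ->
       z k <= z i + z j) /\
    (forall i j k : nonzero 'Z_m, (val i <= val j)%N ->
       (m < val i + val j)%N -> (val k = val i + val j - m :> nat)%N ->
       z k <= z i + z j + 1)].

Definition kunz_shift : {ffun nonzero 'Z_m -> R} :=
  [ffun i : nonzero 'Z_m => - ((val i : nat)%:R / m%:R)].

End Polyhedron.

Arguments group_cone : clear implicits.
Arguments kunz_polyhedron : clear implicits.

(* Main.v *)
Require Import Defs.
From HB Require Import structures.
From mathcomp Require Import all_boot all_order all_fingroup all_algebra.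
From mathcomp Require Import zify ring lra.
From mathcomp Require Import boolp classical_sets cardinality reals.

Set Implicit Arguments.
Unset Strict Implicit.
Unset Printing Implicit Defensive.

Import Order.TTheory GRing.Theory Num.Theory.
Local Open Scope classical_set_scope.
Local Open Scope ring_scope.

(* Subtracting v from the Kunz vector of S gives the point a_i / m of the group *)
(* cone, whose tight inequalities are exactly the relations a_i + a_j = a_(i+j) *)
(* defining the Kunz poset of S. A valid inequality that is tight at one        *)
(* relative interior point of a face is tight on the whole face, so these are   *)
(* also the relations defining the Kunz poset of F - v; the Kunz subgroup is    *)
(* trivial because a_i > 0 for i != 0.                                          *)

(** Subtracting [v] adds [i/m] to coordinate [i], so the slack [z_i + z_j - z_k] grows by
    [(i + j - k)/m]: by 0 if [k = i + j], by 1 if [k = i + j - m]. This absorbs the constant in the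
    second family of inequalities and yields the translation ([kunz_polyhedronE]). For the posets,
    [relative_interior_tight] spreads equalities from the Kunz vector to all of [F], and
    [semigroup_kunz_posetE] reads the same equalities as comparisons in the semigroup. *)

Section Faces.
Variables (R : realType) (I : finType).
Implicit Types (P F : set {ffun I -> R}) (x y v : {ffun I -> R}).

Lemma is_face_translate P F v :
  is_face P F -> is_face [set x + v | x in P] [set x + v | x in F].
Proof.
move=> [c [d [Pd ->]]]; exists c, (d + \sum_i c i * v i).
have dotD x : \sum_i c i * (x + v) i = \sum_i c i * x i + \sum_i c i * v i.
  by rewrite -big_split; apply: eq_bigr => i _; rewrite ffunE mulrDr.
split=> [_ [x Px <-]|]; first by rewrite dotD lerD2r; exact: Pd.
apply/seteqP; split=> [_ [x [Px xd] <-]|_ [[x Px <-] /=]].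
  by split; [exists x|rewrite dotD xd].
by rewrite dotD => /addIr xd; exists x.
Qed.

(** The segment from [y] to a relative interior point [x] can be prolonged beyond [x] inside [F],
    since the prolongation stays in the affine hull. *)
Lemma relative_interior_extend F x y :
  relative_interior F x -> F y -> exists2 t : R, 0 < t & F [ffun i => x i - t * (y i - x i)].
Proof.
move=> [Fx [e e0 xF]] Fy.
(* The summand 1 makes [M] a positive strict bound even when [y = x], so the step [e / M] moves
   every coordinate by less than [e]. *)
pose M := 1 + \sum_i `|y i - x i|.
have leM i : `|y i - x i| < M.
  rewrite /M (bigD1 i) //= ltr_pwDl // lerDl.
  by apply: sumr_ge0 => j _; exact: normr_ge0.
have M0 : 0 < M by rewrite ltr_pwDl // sumr_ge0.
have t0 : 0 < e / M by rewrite divr_gt0.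
exists (e / M) => //; apply: xF => [|i]; last first.
  rewrite ffunE addrAC subrr add0r normrN normrM (gtr0_norm t0).
  by rewrite mulrAC ltr_pdivrMr // ltr_pM2l.
(* With [t = e / M], the point is the affine combination [(1 + t) x - t y]. *)
exists 2%N, (fun k : 'I_2 => if k == 0 then 1 + e / M else - (e / M)),
  (fun k : 'I_2 => if k == 0 then x else y).
split=> [k||i]; first by case: ifP.
  by rewrite big_ord_recl big_ord1 /= addrK.
rewrite big_ord_recl big_ord1 /= ffunE; ring.
Qed.

End Faces.

(** * Apéry sets of numerical semigroups *)

Section Apery.
Variables (S : set nat) (m : nat).
Hypotheses (Ssg : numerical_semigroup S) (Sm : S m) (m_gt0 : (0 < m)%N).

Let S0 : S 0%N. Proof. by case: Ssg. Qed.
Let SD s t : S s -> S t -> S (s + t)%N. Proof. by case: Ssg => _ + _; exact. Qed.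

Lemma semigroup_addM s k : S s -> S (s + k * m)%N.
Proof.
move=> Ss; elim: k => [|k IHk]; first by rewrite mul0n addn0.
by rewrite mulSn addnCA; exact: SD.
Qed.

(** If [b = a + (k + 1) m], then [b - m = a + k m] lies in [S], which bars [b] from the Apéry
    set. *)
Lemma apery_set_uniq a b :
  apery_set S m a -> apery_set S m b -> a = b %[mod m] -> a = b.
Proof.
wlog leab : a b / (a <= b)%N => [hw|].
  by move=> Sa Sb ab; have [/hw|/ltnW/hw ba] := leqP a b; [|apply/esym/ba]; auto.
move=> [Sa _] [_ nSb] /esym/eqP; rewrite eqn_mod_dvd // => /dvdnP[[|k] bak].
  by lia.
case: nSb; split; first by rewrite mulSn in bak; lia.
have -> : (b - m = a + k * m)%N by rewrite mulSn in bak; lia.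
exact: semigroup_addM.
Qed.

Lemma semigroup_meets_class i : exists s, S s /\ s = i %[mod m].
Proof.
have [_ _ /finite_seqP[r rS]] := Ssg.
(* This number exceeds every gap of [S], as [r] lists the gaps and [m] is positive. *)
exists (i + (\max_(s <- r) s).+1 * m)%N; split; last by rewrite addnC modnMDl.
apply: contrapT => nSi.
have : (i + (\max_(s <- r) s).+1 * m)%N \in r.
  by have : (~` S) (i + (\max_(s <- r) s).+1 * m)%N by []; rewrite rS.
move/(leq_bigmax_seq (P := xpredT) (F := id)) => /(_ isT) /=.
move: (\max_(s <- r) s) => M; nia.
Qed.

Lemma aperyP i : apery_set S m (apery S m i) /\ apery S m i = i %[mod m].
Proof.
apply: (@xgetPex _ 0%N [set a | apery_set S m a /\ a = i %[mod m]]).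
have ex : exists s, `[< S s /\ s = i %[mod m] >].
  by have [s Ss] := semigroup_meets_class i; exists s; apply/asboolP.
case: (ex_minnP ex) => a /asboolP[Sa ai] mina; exists a; split=> //; split=> //.
move=> [lema Sam]; have : (a <= a - m)%N; last by lia.
by apply/mina/asboolP; split=> //; rewrite -ai -[in RHS](subnK lema) modnDr.
Qed.

Lemma apery_in i : S (apery S m i).
Proof. by have [[]] := aperyP i. Qed.

Lemma apery_mod i : apery S m i = i %[mod m].
Proof. by have [] := aperyP i. Qed.

Lemma apery_eq i a : apery_set S m a -> a = i %[mod m] -> apery S m i = a.
Proof.
move=> Sa ai; have [Si im] := aperyP i.
by apply: apery_set_uniq => //; rewrite im.
Qed.

Lemma apery0 : apery S m 0 = 0%N.
Proof. by apply: apery_eq => //; split=> // -[]; lia. Qed.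

(** If [a_k - a_i - m] were in [S], adding [a_i] would put [a_k - m] in [S]; hence the difference is
    itself an Apéry element. *)
Lemma apery_sub i j k : i + j = k %[mod m] -> (apery S m i <= apery S m k)%N ->
  S (apery S m k - apery S m i)%N -> apery S m j = (apery S m k - apery S m i)%N.
Proof.
move=> ijk leik Sik; apply: apery_eq.
  split=> // -[lem Sikm]; have [[_ nS] _] := aperyP k; apply: nS.
  split; first by lia.
  have -> : (apery S m k - m =
    apery S m i + (apery S m k - apery S m i - m))%N by lia.
  exact: SD (apery_in _) Sikm.
apply/eqP; rewrite -(eqn_modDl (apery S m i)) subnKC // apery_mod -ijk.
by rewrite -[X in _ == X]modnDml apery_mod modnDml.
Qed.

End Apery.

(** * The Kunz polyhedron as a translate of the group cone *)

Section KunzPolyhedron.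
Variables (R : realType) (m : nat).
Hypothesis m_gt1 : (1 < m)%N.
Local Notation v := (kunz_shift R m).

Lemma val_addZp (a b : 'Z_m) : ((a + b)%R = (a + b) %% m :> nat)%N.
Proof. by move: a b; case: m m_gt1 => [|[|n]]. Qed.

Lemma ltn_valZp (a : 'Z_m) : (a < m)%N.
Proof. by move: a; case: m m_gt1 => [|[|n]] // _ a; exact: ltn_ord. Qed.

Lemma nonzero_gt0 (a : nonzero 'Z_m) : (0 < val a)%N.
Proof. by case: a => a /= a0; rewrite lt0n; apply: contra_neq a0 => a0; exact: val_inj. Qed.

(** A sum in ['Z_m] wraps around at most once, and the boundary case of integer sum [m] is excluded
    because [c] is nonzero. *)
Lemma val_nonzeroD (a b c : nonzero 'Z_m) : val a + val b = val c <->
  (val a + val b < m)%N /\ (val c = val a + val b :> nat)%N \/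
  (m < val a + val b)%N /\ (val c = val a + val b - m :> nat)%N.
Proof.
have := ltn_valZp (val a); have := ltn_valZp (val b); have := nonzero_gt0 c.
set i : nat := val a; set j : nat := val b; set k : nat := val c => k0 jm im.
have -> : (val a + val b = val c) <-> ((i + j) %% m = k)%N.
  by rewrite -val_addZp; split=> [->|/val_inj].
have [lt|ge] := ltnP (i + j) m; first by rewrite modn_small //; lia.
have -> : ((i + j) %% m = i + j - m)%N.
  by rewrite -[in LHS](subnK ge) modnDr modn_small //; lia.
lia.
Qed.

Lemma kunz_polyhedronE z : kunz_polyhedron R m z <-> group_cone R 'Z_m (z - v).
Proof.
have m0 : m%:R != 0 :> R by rewrite pnatr_eq0; lia.
split=> [[z1 z2] a b c /val_nonzeroD abc|zC].
  wlog leab : a b abc / (val a <= val b)%N => [hw|].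
    have [/hw|/ltnW/hw] := leqP (val a) (val b); first exact.
    by rewrite [X in _ <= X]addrC; apply; rewrite [(val b + _)%N]addnC.
  rewrite !ffunE; case: abc => -[ab ck]; rewrite ck.
    by have := z1 _ _ _ leab ab ck; rewrite natrD mulrDl; lra.
  have := z2 _ _ _ leab ab ck; rewrite natrB ?(ltnW ab) // natrD mulrBl mulrDl.
  by rewrite divff //; lra.
split=> a b c leab ab ck.
  have /zC : val a + val b = val c by apply/val_nonzeroD; left.
  by rewrite !ffunE ck natrD mulrDl; lra.
have /zC : val a + val b = val c by apply/val_nonzeroD; right.
by rewrite !ffunE ck natrB ?(ltnW ab) // natrD mulrBl mulrDl divff //; lra.
Qed.

Lemma kunz_polyhedron_translate :
  kunz_polyhedron R m = [set x + v | x in group_cone R 'Z_m].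
Proof.
apply/seteqP; split=> [z /kunz_polyhedronE zC|_ [x xC <-]].
  by exists (z - v) => //; rewrite subrK.
by apply/kunz_polyhedronE; rewrite addrK.
Qed.

Lemma group_cone_translate :
  group_cone R 'Z_m = [set z - v | z in kunz_polyhedron R m].
Proof.
apply/seteqP; split=> [x xC|_ [z /kunz_polyhedronE zC <-]//].
by exists (x + v); rewrite ?addrK // kunz_polyhedron_translate; exists x.
Qed.

(** The slack of the cone inequality vanishes at [x], so at the prolonged point it is [-t] times the
    slack at [y]; both being nonnegative, the slack at [y] is 0. *)
Lemma relative_interior_tight (F : set {ffun nonzero 'Z_m -> R}) x y
    (a b c : nonzero 'Z_m) :
  F `<=` kunz_polyhedron R m -> relative_interior F x -> F y ->
  val a + val b = val c ->
  (x - v) a + (x - v) b = (x - v) c -> (y - v) a + (y - v) b = (y - v) c.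
Proof.
move=> FP xF Fy abc; have [t t0 /FP/kunz_polyhedronE/(_ _ _ _ abc)] :=
  relative_interior_extend xF Fy.
have := (kunz_polyhedronE y).1 (FP _ Fy) _ _ _ abc; rewrite !ffunE => yge tge xE.
(* The final [lra] sees products with [t] as atoms, so the equality at [x] is supplied already
   multiplied by [t]. *)
have txE := congr1 ( *%R t) xE.
by apply/eqP; rewrite eq_le yge andbT -subr_ge0 -(pmulr_rge0 _ t0); lra.
Qed.

End KunzPolyhedron.

(** * The Kunz poset of a numerical semigroup *)

Section KunzPoset.
Variables (S : set nat) (m : nat).
Hypotheses (Ssg : numerical_semigroup S) (Sm : S m) (m_gt1 : (1 < m)%N).
Local Notation ap := (apery S m).
Local Notation le := (semigroup_kunz_poset S (m := m)).
Let m_gt0 : (0 < m)%N. Proof. exact: ltnW. Qed.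

Lemma apery_gt0 (a : nonzero 'Z_m) : (0 < ap (val a))%N.
Proof.
rewrite lt0n; apply/eqP => a0; have := apery_mod Ssg m_gt0 (val a).
rewrite a0 mod0n modn_small ?ltn_valZp // => /esym.
by have := nonzero_gt0 a; lia.
Qed.

Lemma apery_inj (i j : 'Z_m) : ap i = ap j -> i = j.
Proof.
move=> ij; apply: val_inj; have := apery_mod Ssg m_gt0 i.
by rewrite ij apery_mod // !modn_small ?ltn_valZp.
Qed.

Lemma kunz_vector_shiftE (R : realType) (a : nonzero 'Z_m) :
  (kunz_vector S m R - kunz_shift R m) a = (ap (val a))%:R / m%:R.
Proof.
have m0 : m%:R != 0 :> R by rewrite pnatr_eq0; lia.
rewrite !ffunE opprK [in RHS](divn_eq (ap (val a)) m) apery_mod //.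
by rewrite modn_small ?ltn_valZp // natrD natrM mulrDl mulfK.
Qed.

(** By [apery_sub], a difference of Apéry elements that lies in [S] is the Apéry element of the
    difference class. *)
Lemma semigroup_kunz_posetE (a b c : 'Z_m) : a + b = c ->
  le a c <-> (ap a + ap b = ap c)%N.
Proof.
move=> abc; split=> [/asboolP[leac Sac]|abE]; last first.
  by apply/asboolP; rewrite -abE leq_addr addKn; split=> //; exact: apery_in.
rewrite (apery_sub Ssg Sm m_gt0 (i := a) (j := b) (k := c)) ?subnKC //.
by rewrite -abc val_addZp // modn_mod.
Qed.

Lemma semigroup_kunz_poset_refl : reflexive le.
Proof. by move=> i; apply/asboolP; rewrite subnn leqnn; case: Ssg. Qed.

Lemma semigroup_kunz_poset_anti : antisymmetric le.
Proof.
by move=> i j /andP[/asboolP[ij _] /asboolP[ji _]]; apply: apery_inj; lia.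
Qed.

Lemma semigroup_kunz_poset_trans : transitive le.
Proof.
move=> j i k /asboolP[ij Sij] /asboolP[jk Sjk]; apply/asboolP.
split; first exact: leq_trans ij jk.
have -> : (ap k - ap i = (ap j - ap i) + (ap k - ap j))%N by lia.
by case: Ssg => _ SD _; exact: SD.
Qed.

Lemma semigroup_kunz_poset0 i : le 0 i.
Proof. by apply/(semigroup_kunz_posetE (add0r i)); rewrite apery0. Qed.

(** The additive form of the order is symmetric in the two summands [i] and [j - i]. *)
Lemma semigroup_kunz_poset_sub i j : le i j -> le (j - i) j.
Proof.
move/(semigroup_kunz_posetE (subrKC i j)) => ij.
by apply/(semigroup_kunz_posetE (subrK i j)); rewrite addnC.
Qed.

End KunzPoset.

Lemma coset1_inj (gT : finGroupType) : injective (coset 1%G : gT -> _).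
Proof.
move=> x y; apply: (injmP (coset1_injm gT)); rewrite /= norm1; exact: finset.in_setT.
Qed.

Theorem theorem4p7 (R : realType) (m : nat) (hm : (2 <= m)%N) :
  let v := kunz_shift R m in
  kunz_polyhedron R m = [set x + v | x in group_cone R 'Z_m] /\
  (forall F : set {ffun nonzero 'Z_m -> R},
     is_face (kunz_polyhedron R m) F ->
     is_face (group_cone R 'Z_m) [set z - v | z in F] /\
     (forall S : set nat,
        numerical_semigroup S -> S m ->
        relative_interior F (kunz_vector S m R) ->
        exists (H : {group 'Z_m}) (le : rel (coset_of H)),
          [/\ is_face_kunz_poset [set z - v | z in F] le,
              H = [set 0]%SET :> {set 'Z_m} &
              forall i j : 'Z_m,
                semigroup_kunz_poset S i j = le (coset H i) (coset H j)])).
Proof.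
move=> v; split; first exact: kunz_polyhedron_translate.
move=> F Fface; split; first by rewrite group_cone_translate //; exact: is_face_translate.
move=> S Ssg Sm xF; have Fx : F (kunz_vector S m R) by case: xF.
have FP : F `<=` kunz_polyhedron R m by case: Fface => c [d [_ ->]] z [].
have m_inv : (m%:R^-1 : R) != 0 by rewrite invr_eq0 pnatr_eq0; lia.
have nH (x : 'Z_m) : x \in 'N(1)%g by rewrite norm1 finset.in_setT.
have repr1 (i : 'Z_m) : repr (coset 1%G i) = i by apply/coset1_inj/coset_reprK.
(* The face poset must live on a quotient, here by the trivial subgroup; [repr] inverts the
   projection and transports the order. *)
pose le := fun u w : coset_of (1%G : {group 'Z_m}) =>
  semigroup_kunz_poset S (repr u) (repr w).
exists 1%G, le; split; last by move=> i j; rewrite /le !repr1.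
- split.
  + move=> g; rewrite inE; split=> [/eqP->|[->//|[h <- h0]]]; first by left.
    (* Evaluated at the shifted Kunz vector, coordinate [h] is [a_h / m], which is nonzero. *)
    have /eqP := h0 _ (imageP (fun z => z - v) Fx).
    rewrite kunz_vector_shiftE // mulf_eq0 (negPf m_inv) orbF pnatr_eq0.
    by have := apery_gt0 Ssg hm h; lia.
  + split=> [u|u w /(semigroup_kunz_poset_anti Ssg hm)|w u x].
    * exact: semigroup_kunz_poset_refl.
    * by move/(congr1 (coset 1%G)); rewrite !coset_reprK.
    * exact: semigroup_kunz_poset_trans.
  + split=> [u|u w]; first by rewrite /le repr_coset1; exact: semigroup_kunz_poset0.
    rewrite -(coset_reprK u) -(coset_reprK w) -morphV // -morphM // /le !repr1.
    exact: semigroup_kunz_poset_sub.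
  + move=> a b c abc; rewrite -morphM // /le !repr1 FinRing.zmodMgE abc.
    rewrite (semigroup_kunz_posetE Ssg Sm hm abc); split=> [tight|apE].
      have := tight _ (imageP (fun z => z - v) Fx).
      by rewrite !kunz_vector_shiftE // -mulrDl => /(mulIf m_inv)/eqP;
        rewrite -natrD eqr_nat => /eqP.
    move=> _ [y Fy <-]; apply: (relative_interior_tight hm FP xF Fy abc).
    by rewrite !kunz_vector_shiftE // -mulrDl -natrD apE.
- by [].
Qed.
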